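(* Let $D$ be an open neighbourhood of $\mathbb{R}^n_+$ and let $f,g:D\to\mathbb{R}^n$ be $C^1$ maps such that $(f+g)(0)=0$, $g(x)\geq 0$ for all $x\in\mathbb{R}^n_+$, and $f_i(x)\geq 0$ for all $i$ and all $x\in\mathbb{R}^n_+$ with $x_i=0$. Suppose that $f$ and $g$ are subhomogeneous of degree $\alpha>0$. Assume that for every $w\in\mathbb{R}^n_+\setminus\{0\}$ there is some index $i\in\{1,\dots,n\}$ such that $$\sup\{g_i(y): 0\leq y\leq w\} < -\sup\{f_i(x): 0\leq x\leq w,\ x_i=w_i\}.$$ Then for every $\tau\geq 0$, the origin is a globally asymptotically stable equilibrium of the time-delay system $$\dot{x}(t)=f(x(t))+g(x(t-\tau))$$ on the state space $C([-\tau,0],\mathbb{R}^n_+)$.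
   Context: $\mathbb{R}^n_+$ is the nonnegative orthant. For $x,y\in\mathbb{R}^n$, $x\geq y$ means $x_i\geq y_i$ for all $i$. A map $f$ is subhomogeneous of degree $\alpha>0$ if $f(\lambda x)\leq \lambda^\alpha f(x)$ for all $\lambda\geq 1$ and all $x\in\mathbb{R}^n_+$ (componentwise inequality). Under the stated sign conditions on $f$ and $g$ the delay system is positive: for initial conditions $\phi\in C([-\tau,0],\mathbb{R}^n_+)$ the solution $x(t,\phi)$ stays in $\mathbb{R}^n_+$. Global asymptotic stability of the origin means it is Lyapunov stable and every solution with initial condition in $C([-\tau,0],\mathbb{R}^n_+)$ converges to $0$ as $t\to\infty$. *)

(* Defs.v *)
From HB Require Import structures.
From mathcomp Require Import all_boot all_order all_algebra.
From mathcomp Require Import all_classical all_reals all_analysis.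
Set Implicit Arguments. Unset Strict Implicit. Unset Printing Implicit Defensive.
Import Order.TTheory GRing.Theory Num.Theory.
Import numFieldNormedType.Exports.
Local Open Scope classical_set_scope.
Local Open Scope ring_scope.

Section Defs.
Variables (R : realType) (n : nat).
Notation V := 'rV[R]_n.

Definition nonneg (x : V) : Prop := forall i : 'I_n, 0 <= x ord0 i.

Definition vle (x y : V) : Prop := forall i : 'I_n, x ord0 i <= y ord0 i.

Definition box (w : V) : set V := [set y | vle 0 y /\ vle y w].

(* f is C^1 on the open set D: differentiable at every point of D, with
   derivative depending continuously on the point (tested in every direction,
   i.e. continuous partial/directional derivatives). *)
Definition C1_on (D : set V) (f : V -> V) : Prop :=
  (forall x, D x -> differentiable f x) /\
  (forall v : V, forall x, D x -> {for x, continuous (fun y => 'd f y v)}).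

Definition subhomogeneous (alpha : R) (f : V -> V) : Prop :=
  forall (lam : R) (x : V), 1 <= lam -> nonneg x ->
    forall i : 'I_n, f (lam *: x) ord0 i <= lam `^ alpha * f x ord0 i.

Definition init_data (tau : R) (phi : R -> V) : Prop :=
  {within `[- tau, 0], continuous phi} /\
  (forall s, - tau <= s <= 0 -> nonneg (phi s)).

Definition dde_solution (f g : V -> V) (tau : R) (phi x : R -> V) : Prop :=
  [/\ {within `[- tau, +oo[, continuous x},
      (forall s, - tau <= s <= 0 -> x s = phi s) &
      (forall t : R, 0 < t -> is_derive t (1 : R) x (f (x t) + g (x (t - tau))))].

Definition GAS (f g : V -> V) (tau : R) : Prop :=
  [/\
      (forall phi, init_data tau phi -> exists x, dde_solution f g tau phi x),
      (forall eps : R, 0 < eps -> exists2 delta : R, 0 < delta &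
         forall phi x, init_data tau phi ->
           (forall s, - tau <= s <= 0 -> `|phi s| < delta) ->
           dde_solution f g tau phi x ->
           forall t : R, 0 <= t -> `|x t| < eps) &
      (forall phi x, init_data tau phi -> dde_solution f g tau phi x ->
         x t @[t --> +oo%R] --> (0 : V))].

End Defs.

(* Main.v *)
Require Import Defs.
From HB Require Import structures.
From mathcomp Require Import all_boot all_order all_algebra.
From mathcomp Require Import all_classical all_reals all_analysis.
From mathcomp Require Import ring lra.
Import Order.TTheory GRing.Theory Num.Theory.
Import numFieldNormedType.Exports.
Local Open Scope classical_set_scope.
Local Open Scope ring_scope.
Set Implicit Arguments. Unset Strict Implicit. Unset Printing Implicit Defensive.

(* Let F_i(w) be the supremum of f_i over the x in the box [0, w] with x_i = w_i, and
   G_i(w) the supremum of g_i over [0, w]. Then F + G is quasimonotone, and the hypothesis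
   says that (F + G)(w) >= 0 fails for every nonzero w >= 0.

   There are arbitrarily small v >> 0 with (F + G)(v) << 0. Indeed, by compactness there
   is e > 0 such that no w with r/2 <= max_i w_i <= r satisfies F + G >= - e. The set A of
   the w in [0, r]^n with (F + G)(w) >= - e contains 0 and is closed under coordinatewise
   maxima by quasimonotonicity. At its coordinatewise supremum v one has F + G << 0,
   since otherwise some coordinate could be increased without leaving A.

   By subhomogeneity (F + G)(m v) <= - e for all m >= 1. Hence [0, m v] is invariant, and a
   solution that is eventually in [0, m v] with m > 1 is eventually in [0, m' v], where
   m' = max (m - d) 1 for a uniform d > 0. So every solution is eventually in [0, v].

   Existence: Picard iteration for the system precomposed with the projection onto the
   invariant box. Uniqueness, by local Lipschitz continuity on D, shows that an arbitrary
   solution is that one, hence stays in the box. *)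

(** * Row vectors and Lipschitz estimates *)

Section RowVectors.
Context {R : realType} {n : nat}.
Implicit Types x y : 'rV[R]_n.

Lemma coord_le_norm x i : `|x ord0 i| <= `|x|.
Proof.
rewrite [leRHS]/Num.Def.normr/= mx_normrE.
exact: (le_bigmax _ (fun ij => `|x ij.1 ij.2|) (ord0, i)).
Qed.

Lemma norm_le_coord x c : 0 <= c -> (forall i, `|x ord0 i| <= c) -> `|x| <= c.
Proof.
move=> c0 h; rewrite [leLHS]/Num.Def.normr/= mx_normrE.
by apply: bigmax_le => // -[i j] _ /=; rewrite ord1.
Qed.

Lemma is_derive_coord (x : R -> 'rV[R]_n) (d : 'rV[R]_n) t i :
  is_derive t (1 : R) x d -> is_derive t 1 (fun s => x s ord0 i) (d ord0 i).
Proof.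
move=> [dx <-]; rewrite derive_mx// mxE.
by apply: derivableP; move/derivable_mxP : dx; exact.
Qed.

Lemma coord_is_derive (x : R -> 'rV[R]_n) (d : 'rV[R]_n) t :
  (forall i, is_derive t (1 : R) (fun s => x s ord0 i) (d ord0 i)) ->
  is_derive t (1 : R) x d.
Proof.
move=> dx; have hx : derivable x t 1.
  by apply/derivable_mxP => i j; rewrite ord1; have [] := dx j.
apply: DeriveDef => //; rewrite derive_mx//; apply/rowP => i.
by rewrite mxE; exact: derive_val.
Qed.

End RowVectors.

(** * Lipschitz constants from continuous derivatives *)

Section Lipschitz.
Context {R : realType} {n : nat}.
Notation V := 'rV[R]_n.
Implicit Types (f : V -> V) (D K : set V).

Definition lipschitz_on (K : set V) (f : V -> V) (L : R) :=
  forall x y, K x -> K y -> forall i,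
    `|f x ord0 i - f y ord0 i| <= L * `|x - y|.

Definition segment_closed (K : set V) :=
  forall x y, K x -> K y -> forall s : R, 0 <= s <= 1 -> K (x + s *: (y - x)).

Lemma is_derive_line f (x v : V) (s : R) i :
  differentiable f (x + s *: v) ->
  is_derive s (1 : R) (fun s => f (x + s *: v) ord0 i)
    ('d f (x + s *: v) v ord0 i).
Proof.
move=> df; apply: (@is_derive_coord _ _ (fun s => f (x + s *: v))).
have dl : is_diff s (fun s : R => x + s *: v) ( *:%R ^~ v).
  by apply: is_diff_eq; apply/funext => h /=; rewrite !fctE add0r.
have dc : differentiable (fun s : R => f (x + s *: v)) s.
  by apply: (@differentiable_comp _ _ _ _ (fun s : R => x + s *: v) f).
apply: DeriveDef; first exact/derivable1_diffP.
rewrite deriveE//.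
rewrite (_ : (fun s : R => f (x + s *: v)) = f \o (fun s : R => x + s *: v))//.
by rewrite diff_comp//= diff_val scale1r.
Qed.

(** Mean value theorem along the segment from [y] to [x]: the derivative in the direction [x - y]
    expands in the standard basis into [n] terms, each at most [M * |x - y|]. *)
Lemma bounded_diff_lipschitz K f (M : R) :
  segment_closed K -> 0 <= M -> (forall x, K x -> differentiable f x) ->
  (forall x, K x -> forall i j, `|'d f x (delta_mx ord0 j) ord0 i| <= M) ->
  lipschitz_on K f (n%:R * M).
Proof.
move=> cK M0 dK bK x y Kx Ky i.
pose phi (s : R) := f (y + s *: (x - y)) ord0 i.
have dphi (s : R) : 0 <= s <= 1 ->
    is_derive s (1 : R) phi ('d f (y + s *: (x - y)) (x - y) ord0 i).
  by move=> s01; apply: is_derive_line; apply: dK; exact: cK.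
have [||s] := @MVT_segment R phi
  (fun s => 'd f (y + s *: (x - y)) (x - y) ord0 i) 0 1 ler01.
- by move=> s; rewrite in_itv/= => /andP[/ltW s0 /ltW s1]; apply: dphi; rewrite s0.
- apply: derivable_within_continuous => s; rewrite in_itv/= => s01.
  by have [] := dphi s s01.
rewrite in_itv/= => s01.
rewrite /phi scale1r scale0r addr0 subr0 mulr1 (addrC y) subrK => ->.
set z := y + _.
have -> : 'd f z (x - y) = \sum_j (x - y) ord0 j *: 'd f z (delta_mx ord0 j).
  rewrite {1}[x - y]row_sum_delta linear_sum.
  by apply: eq_bigr => j _; rewrite linearZ.
rewrite summxE (le_trans (ler_norm_sum _ _ _))//.
apply: (@le_trans _ _ (\sum_(j < n) M * `|x - y|)); last first.
  by rewrite sumr_const card_ord -mulrA mulr_natl.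
apply: ler_sum => j _; rewrite mxE normrM mulrC.
by apply: ler_pM => //; [apply: bK; exact: cK|exact: coord_le_norm].
Qed.

(** [C1_on] gives continuity one direction at a time. Finitely many basis directions suffice, and
    the sum over all of them, plus 1 for the variation near [x], serves every [j]. *)
Lemma near_diff_bound f (x : V) :
  (forall v : V, {for x, continuous (fun y => 'd f y v)}) ->
  \forall x' \near x, forall j : 'I_n, `|'d f x' (delta_mx ord0 j)| <=
    \sum_(j < n) `|'d f x (delta_mx ord0 j)| + 1.
Proof.
move=> cf; refine (@filter_forall _ _ (fun (j : 'I_n) x' =>
  `|'d f x' (delta_mx ord0 j)| <= _) _ (nbhs_filter x) _) => j.
have /cvgrPdist_le/(_ 1 ltr01) := cf (delta_mx ord0 j).
apply: filterS => x'; rewrite distrC => hx'; rewrite -lerBlDl.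
apply: le_trans (le_trans (lerB_dist _ _) hx').
by rewrite lerB// (bigD1 j)//= lerDl sumr_ge0.
Qed.

Lemma C1_compact_lipschitz D K f : C1_on D f -> K `<=` D -> compact K ->
  segment_closed K -> exists2 L, 0 <= L & lipschitz_on K f L.
Proof.
move=> [df cf] KD /compact_near_coveringP cK sK.
have [M /andP[M0 hM]] : exists M : R, (0 <= M) && `[< forall x, K x -> forall i j,
    `|'d f x (delta_mx ord0 j) ord0 i| <= M >].
  suff : \forall M \near pinfty_nbhs R, 0 <= M /\ forall x, K x -> forall i j,
      `|'d f x (delta_mx ord0 j) ord0 i| <= M.
    move=> /filter_ex[M [M0 hM]]; exists M; rewrite M0; exact/asboolP.
  apply: filterI; first exact: (nbhs_pinfty_ge (num_real _)).
  apply: (cK R (pinfty_nbhs R) (fun M x => forall i j,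
      `|'d f x (delta_mx ord0 j) ord0 i| <= M)) => x Kx.
  pose S := \sum_(j < n) `|'d f x (delta_mx ord0 j)| + 1.
  have hx : \forall x' \near x, forall j : 'I_n, `|'d f x' (delta_mx ord0 j)| <= S.
    exact: near_diff_bound (fun v => cf v x (KD _ Kx)).
  have hS : \forall M \near pinfty_nbhs R, S <= M.
    exact: (nbhs_pinfty_ge (num_real _)).
  near=> x' M => i j /=; apply: (@le_trans _ _ S); last by near: M.
  by apply: le_trans (coord_le_norm _ _) _; move: j; near: x'.
exists (n%:R * M); first by rewrite mulr_ge0.
by apply: bounded_diff_lipschitz => // [x /KD/df//|]; exact/asboolP.
Unshelve. all: by end_near. Qed.

Lemma C1_locally_lipschitz D f x0 : open D -> C1_on D f -> D x0 ->
  exists2 L, 0 <= L & exists2 r : R, 0 < r & lipschitz_on (ball x0 r) f L.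
Proof.
move=> oD [df cf] Dx0.
pose M := \sum_(j < n) `|'d f x0 (delta_mx ord0 j)| + 1.
have : \forall x \near x0, D x /\ forall j : 'I_n, `|'d f x (delta_mx ord0 j)| <= M.
  apply: filterI; first exact: open_nbhs_nbhs.
  exact: near_diff_bound (fun v => cf v x0 Dx0).
move=> /nbhs_ballP[r /= r0 rD].
exists (n%:R * M); first by rewrite mulr_ge0// addr_ge0// sumr_ge0.
exists r => //; apply: bounded_diff_lipschitz.
- move=> x y; rewrite -!ball_normE/= => xr yr s /andP[s0 s1].
  have -> : x0 - (x + s *: (y - x)) = (1 - s) *: (x0 - x) + s *: (x0 - y).
    by apply/rowP => k; rewrite !mxE; ring.
  rewrite (le_lt_trans (ler_normD _ _))// !normrZ !ger0_norm ?subr_ge0//.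
  have := normr_ge0 (x0 - x); have := normr_ge0 (x0 - y).
  move: xr yr; set a := `|_|; set b := `|_| => ar br b0 a0.
  by have [->|] := eqVneq s 0; [lra|]; rewrite neq_lt ltNge s0/= => ?; nra.
- by rewrite addr_ge0// sumr_ge0.
- by move=> x /rD[/df].
- by move=> x /rD[_ h] i j; exact: le_trans (coord_le_norm _ _) (h j).
Qed.

End Lipschitz.

(** * Small points of decay *)

Section Box.
Context {R : realType} {n : nat}.
Notation V := 'rV[R]_n.
Implicit Types (w x y : V) (r : R).

Lemma boxP w x : box w x <-> forall i, 0 <= x ord0 i <= w ord0 i.
Proof.
split=> [[x0 xw] i|h]; first by have := x0 i; rewrite mxE xw => ->.
by split=> i; [rewrite mxE|]; have /andP[] := h i.
Qed.

Definition cube r : set V := box (const_mx r).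

Lemma cubeP r x : cube r x <-> forall i, 0 <= x ord0 i <= r.
Proof. by split=> [/boxP h i|h]; [have := h i|apply/boxP => i]; rewrite mxE. Qed.

Lemma box_cube r w x : (forall i, w ord0 i <= r) -> box w x -> cube r x.
Proof.
move=> wr /boxP xw; apply/cubeP => i; have /andP[-> /le_trans->//] := xw i.
Qed.

Lemma segment_closed_box w : segment_closed (box w).
Proof.
move=> x y /boxP hx /boxP hy s /andP[s0 s1]; apply/boxP => i; rewrite !mxE.
have /andP[x0 xw] := hx i; have /andP[y0 yw] := hy i.
by apply/andP; split; nra.
Qed.

Lemma box_compact (a b : 'I_n -> R) :
  compact [set x : V | forall i, a i <= x ord0 i <= b i].
Proof.
rewrite (_ : [set _ | _] =
    [set x : V | forall i, [set` `[a i, b i]%R] (x ord0 i)]).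
  by apply: (@rV_compact R n (fun i => [set` `[a i, b i]%R])) => i;
     exact: segment_compact.
by apply/seteqP; split=> x /= h i; have := h i; rewrite in_itv.
Qed.

(** Coordinates of [x] lying on the upper face of [box w] are moved to the upper face of [box w'];
    the others are only truncated at [w']. *)
Lemma box_transfer w w' x : nonneg w' -> box w x ->
  exists x', [/\ box w' x', `|x - x'| <= `|w - w'| &
    forall i, x ord0 i = w ord0 i -> x' ord0 i = w' ord0 i].
Proof.
move=> w'0 /boxP xw.
exists (\row_i if x ord0 i == w ord0 i then w' ord0 i
               else Num.min (x ord0 i) (w' ord0 i)); split.
- apply/boxP => i; rewrite mxE; have := w'0 i; have /andP[x0 _] := xw i.
  by case: ifP => _ h; [rewrite h lexx|rewrite le_min x0 h ge_min lexx orbT].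
- apply: norm_le_coord => // i; apply: le_trans (coord_le_norm _ i).
  rewrite !mxE; case: eqP => [->//|_]; have /andP[x0 xwi] := xw i.
  case: (leP (x ord0 i) (w' ord0 i)) => h; first by rewrite subrr normr0.
  by rewrite !ger0_norm ?subr_ge0 ?lerB//; lra.
- by move=> i /eqP h; rewrite mxE h.
Qed.

End Box.

Section DecayPoint.
Context {R : realType} {n : nat}.
Notation V := 'rV[R]_n.
Variables f g : V -> V.

(* [decay w e] says that [F w + G w <= - e] for the quasimonotone majorants
   [F_i w = sup f_i] over [{x in box w | x_i = w_i}] and [G_i w = sup g_i] over [box w]. *)
Definition decay (w : V) (e : R) :=
  forall i x y, box w x -> box w y -> x ord0 i = w ord0 i ->
    f x ord0 i + g y ord0 i <= - e.

(** Encodes [F_i w + G_i w >= - e] by points realising the bound, which avoids manipulating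
    suprema. *)
Definition reaches (w : V) (i : 'I_n) (e : R) := exists x y,
  [/\ box w x, box w y, x ord0 i = w ord0 i & - e <= f x ord0 i + g y ord0 i].

(** Quasimonotonicity of [F + G]: the box grows while the face [x_i = w_i] keeps its level, so the
    same witnesses serve. *)
Lemma reaches_monotone w w' i e : vle w w' -> w ord0 i = w' ord0 i ->
  reaches w i e -> reaches w' i e.
Proof.
move=> ww' wi [x [y [/boxP bx /boxP b_y xi h]]].
exists x, y; split=> //; last by rewrite xi.
- by apply/boxP => k; have /andP[-> /le_trans->] := bx k.
- by apply/boxP => k; have /andP[-> /le_trans->] := b_y k.
Qed.

(** The witnesses are carried over by [box_transfer]; [f] and [g] each lose at most
    [L * |w - w'|]. *)
Lemma reaches_perturb r L w w' i e :
  lipschitz_on (cube r) f L -> lipschitz_on (cube r) g L -> 0 <= L ->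
  cube r w -> cube r w' -> reaches w i e ->
  reaches w' i (e + 2 * L * `|w - w'|).
Proof.
move=> lf lg L0 cw cw' [x [y [bx b_y xi h]]].
have /cubeP w'r := cw'; have /cubeP wr := cw.
have w'0 : nonneg w' by move=> k; have /andP[] := w'r k.
have [x' [bx' dx xi']] := box_transfer w'0 bx.
have [y' [by' dy _]] := box_transfer w'0 b_y.
exists x', y'; split => //; first exact: xi'.
have wle k : w ord0 k <= r by have /andP[] := wr k.
have w'le k : w' ord0 k <= r by have /andP[] := w'r k.
have := lf _ _ (box_cube wle bx) (box_cube w'le bx') i.
have := lg _ _ (box_cube wle b_y) (box_cube w'le by') i.
have := ler_wpM2l L0 dx; have := ler_wpM2l L0 dy.
rewrite !ler_norml => ? ? /andP[_ ?] /andP[_ ?]; lra.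
Qed.

Hypothesis lip : forall r, 0 < r -> exists L, [/\ 0 < L,
  lipschitz_on (cube r) f L & lipschitz_on (cube r) g L].
Hypothesis fg0 : f 0 + g 0 = 0.
Hypothesis gap : forall w, nonneg w -> w != 0 -> exists i, exists2 c, 0 < c &
  forall x y, box w x -> box w y -> x ord0 i = w ord0 i ->
    f x ord0 i + g y ord0 i <= - c.

(** Compactness makes the margin of [gap] uniform away from the origin: by [reaches_perturb], the
    index and half the margin found at [w] remain valid near [w]. *)
Lemma not_reaches_near_boundary r : 0 < r -> exists2 e, 0 < e &
  forall w k, cube r w -> r / 2 <= w ord0 k -> exists i, ~ reaches w i e.
Proof.
move=> r0; have [L [L0 lf lg]] := lip r0.
pose Q (k : 'I_n) (e : R) := forall w, cube r w ->
  r / 2 <= w ord0 k -> exists i, ~ reaches w i e.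
(* For each [k] the claim is shown for all small [e > 0], so that the finitely many [k] can share
   one [e]. *)
suff /(@filter_forall _ _ Q _ (at_right_proper_filter 0)) H :
    forall k, \forall e \near 0^'+, Q k e.
  have : \forall e \near 0^'+, 0 < e /\ forall k, Q k e.
    by apply: filterI; [exact: nbhs_right_gt|exact: H].
  by move=> /filter_ex[e [e0 he]]; exists e => // w k; exact: he.
move=> k.
(* The slice [w_k >= r / 2] of the cube is a product of the intervals [[a j, r]], hence compact. *)
pose a j := if j == k then r / 2 else 0.
have /compact_near_coveringP := @box_compact R n a (fun=> r).
move=> /(_ R (0^'+) (fun e w => cube r w -> exists i, ~ reaches w i e)).
move=> /(_ _ _) cov.
suff H : forall w : V, (forall i, a i <= w ord0 i <= r) ->
    \forall w' \near w & e \near 0^'+, cube r w' -> exists i, ~ reaches w' i e.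
  apply: filterS (cov H) => e he w cw hk; apply: he => // i; have /cubeP/(_ i) := cw.
  by rewrite /a; case: eqP => [->|//] /andP[_ ->]; rewrite hk.
move=> w hw.
have wnn : nonneg w.
  move=> j; have /andP[h _] := hw j; apply: le_trans h.
  by rewrite /a; case: ifP => _ //; rewrite ltW// divr_gt0.
have cw : cube r w by apply/cubeP => j; rewrite wnn; have /andP[] := hw j.
have w0 : w != 0.
  apply/eqP => w0; have /andP[+ _] := hw k.
  by rewrite /a eqxx w0 mxE leNgt divr_gt0.
have [i [c c0 hc]] := gap wnn w0.
have hx : \forall w' \near w, 2 * L * `|w' - w| < c / 2.
  near=> w'; rewrite mulrC -ltr_pdivlMr ?mulr_gt0//.
  near: w'; apply: cvgr_distC_lt => //.
  by rewrite !divr_gt0// mulr_gt0.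
have he : \forall e \near 0^'+, e < c / 2.
  by apply: nbhs_right_lt; rewrite divr_gt0.
(* Moving the witnesses back to [w] gives a value at least [- (e + 2 * L * |w' - w|) > - c], against
   the choice of [c]. *)
near=> w' e => /= cw'; exists i => /(reaches_perturb lf lg (ltW L0) cw' cw).
move=> [x [y [bx b_y xi]]]; have := hc _ _ bx b_y xi.
have : 2 * L * `|w' - w| < c / 2 by near: w'.
have : e < c / 2 by near: e.
lra.
Unshelve. all: by end_near. Qed.

Hypothesis boundary : forall x i, nonneg x -> x ord0 i = 0 -> 0 <= f x ord0 i.
Hypothesis g_ge0 : forall x i, nonneg x -> 0 <= g x ord0 i.

(** The set A of the overview. *)
Definition reachable r e : set V :=
  [set w | cube r w /\ forall i, reaches w i e].

Lemma reachable0 r e : 0 <= r -> 0 <= e -> reachable r e 0.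
Proof.
move=> r0 e0; split; first by apply/cubeP => i; rewrite mxE lexx.
have b0 : box 0 (0 : V) by apply/boxP => i; rewrite mxE lexx.
move=> i; exists 0, 0; split=> //.
by move/rowP/(_ i) : fg0; rewrite !mxE => ->; rewrite oppr_le0.
Qed.

(** At each coordinate the maximum agrees with one of the two points and dominates it everywhere, so
    [reaches_monotone] applies. *)
Lemma reachable_max r e w w' : reachable r e w -> reachable r e w' ->
  reachable r e (\row_i Num.max (w ord0 i) (w' ord0 i)).
Proof.
move=> [/cubeP cw hw] [/cubeP cw' hw']; split.
  apply/cubeP => i; rewrite mxE le_max ge_max.
  by have /andP[-> ->] := cw i; have /andP[_ ->] := cw' i.
move=> i; case: (leP (w ord0 i) (w' ord0 i)) => h.
- apply: reaches_monotone (hw' i); last by rewrite mxE max_r.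
  by move=> j; rewrite mxE le_max lexx orbT.
- apply: reaches_monotone (hw i); last by rewrite mxE max_l// ltW.
  by move=> j; rewrite mxE le_max lexx.
Qed.

(** A single point approximates all the coordinate suprema at once: take the maximum of one
    approximant per coordinate, by induction on the list of coordinates. *)
Lemma near_supremum_reachable r e d : 0 <= r -> 0 <= e -> 0 < d ->
  exists2 w, reachable r e w & forall i,
    sup [set v ord0 i | v in reachable r e] - d < w ord0 i.
Proof.
move=> r0 e0 d0.
have hs i : has_sup [set v ord0 i | v in reachable r e].
  split; first by exists ((0 : V) ord0 i); exists 0 => //; exact: reachable0.
  by exists r => _ [v [/cubeP cv _] <-]; have /andP[] := cv i.
suff [w Aw hw] : exists2 w, reachable r e w & forall i, i \in enum 'I_n ->
    sup [set v ord0 i | v in reachable r e] - d < w ord0 i.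
  by exists w => // i; apply: hw; rewrite mem_enum.
elim: (enum _) => [|i s [w Aw hw]]; first by exists 0 => //; exact: reachable0.
have [_ [v Av <-] hv] := sup_adherent d0 (hs i).
exists (\row_j Num.max (v ord0 j) (w ord0 j)); first exact: reachable_max.
move=> j; rewrite mxE lt_max inE => /orP[/eqP ->|/hw ->]; last by rewrite orbT.
by rewrite hv.
Qed.

(* The coordinatewise supremum of [reachable r e] is a maximal point: if [F_i + G_i > - e]
   at that point, its [i]-th coordinate could be increased. *)
Lemma exists_decay r : 0 < r -> exists w : V, exists2 e, 0 < e &
  (forall i, 0 < w ord0 i <= r) /\ decay w e.
Proof.
move=> r0; have [e e0 he] := not_reaches_near_boundary r0.
have [L [L0 lf lg]] := lip r0.
(* Points of A stay below [r / 2], which leaves room inside the cube for increasing a coordinate. *)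
have Alt w k : reachable r e w -> w ord0 k < r / 2.
  move=> [cw hw]; rewrite ltNge; apply/negP => h.
  by have [i] := he _ _ cw h; exact.
pose s : V := \row_i sup [set v ord0 i | v in reachable r e].
have les w i : reachable r e w -> w ord0 i <= s ord0 i.
  move=> Aw; rewrite mxE; apply: ub_le_sup; last by exists w.
  by exists r => _ [v [/cubeP cv _] <-]; have /andP[] := cv i.
have s0 i : 0 <= s ord0 i.
  by have := les 0 i (reachable0 (ltW r0) (ltW e0)); rewrite mxE.
have sr i : s ord0 i <= r / 2.
  rewrite mxE; apply: ge_sup.
    by exists ((0 : V) ord0 i); exists 0 => //; exact: reachable0 (ltW _) (ltW _).
  by move=> _ [v Av <-]; exact: ltW (Alt _ _ Av).
have cs : cube r s.
  by apply/cubeP => i; rewrite s0 (le_trans (sr i))//; lra.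
have ds : decay s (e / 2).
  move=> i x y bx b_y xi; rewrite leNgt; apply/negP => h.
  have {h xi bx b_y} hi : reaches s i (e / 2) by exists x, y; split=> //; exact: ltW.
  (* The first bound keeps the raised point in the cube, since [r / 2 + 2 * d <= r]; the second
     gives [e / 2 + 2 * L * (2 * d) <= e]. *)
  pose d := Num.min (r / 8) (e / (8 * L)).
  have d0 : 0 < d by rewrite lt_min !divr_gt0// mulr_gt0.
  have dr : d <= r / 8 by rewrite ge_min lexx.
  have dL : d * (8 * L) <= e.
    by rewrite -ler_pdivlMr ?mulr_gt0// ge_min lexx orbT.
  have [w Aw hw] := near_supremum_reachable (ltW r0) (ltW e0) d0.
  have {}hw j : s ord0 j - d < w ord0 j by have := hw j; rewrite [s _ j]mxE.
  (* As [w_i > s_i - d], the raised coordinate exceeds [s_i]; membership of [w'] in A is then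
     absurd. *)
  pose w' : V := \row_j if j == i then w ord0 i + 2 * d else w ord0 j.
  have ww' : vle w w'.
    by move=> j; rewrite mxE; case: eqP => [->|//]; rewrite lerDl; lra.
  have cw' : cube r w'.
    apply/cubeP => j; have [/cubeP/(_ j) /andP[wj0 wjr] _] := Aw.
    rewrite (le_trans wj0 (ww' j)) mxE; case: eqP => // _.
    by have := Alt _ i Aw; lra.
  suff Aw' : reachable r e w'.
    by have := les _ i Aw'; have := hw i; rewrite /w' [X in X <= _]mxE eqxx; lra.
  split=> // j; have [->|ji] := eqVneq j i; last first.
    have [_ /(_ j)] := Aw; apply: reaches_monotone => //.
    by rewrite mxE (negbTE ji).
  have [x' [y' [bx by' xi h]]] := reaches_perturb lf lg (ltW L0) cs cw' hi.
  exists x', y'; split => //; apply: le_trans h.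
  suff : `|s - w'| <= 2 * d by nra.
  apply: norm_le_coord => [|k]; first lra.
  rewrite [(s - w') _ _]mxE [(- w') _ _]mxE [w' _ _]mxE ler_norml.
  have := les _ k Aw; have := hw k.
  by case: eqP => [->|_]; lra.
exists s, (e / 2); first by rewrite divr_gt0.
split=> // i; have /cubeP/(_ i) /andP[_ ->] := cs; rewrite andbT lt_neqAle s0 andbT.
(* A zero coordinate of [s] would give [f_i s + g_i s >= 0] by the sign conditions, against [ds]. *)
apply/eqP => si.
have bs : box s s by apply/boxP => j; rewrite s0 lexx.
have := ds i s s bs bs erefl; have := boundary s0 (esym si); have := g_ge0 i s0; lra.
Qed.

End DecayPoint.

(** * Picard iteration for delay equations *)

Section Picard.
Context {R : realType}.

Lemma continuous_max0 : continuous (fun t : R => Num.max t 0).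
Proof.
move=> t; apply/cvgrPdist_le => e e0; near=> s.
apply: (@le_trans _ _ `|t - s|).
  have := ler_norm (t - s); have := ler_norm (s - t).
  rewrite (distrC s) => ? ?; rewrite ler_norml.
  by case: (leP t 0); case: (leP s 0); lra.
by near: s; exact: cvgr_dist_le.
Unshelve. all: by end_near. Qed.

Lemma is_derive_continuous {W : normedModType R} (h : R -> W) (t : R) d :
  is_derive t (1 : R) h d -> {for t, continuous h}.
Proof. by move=> [/derivable1_diffP/differentiable_continuous]. Qed.

Lemma continuous_maxr (a : R) : continuous (fun t : R => Num.max t a).
Proof.
move=> t; have -> : (fun t : R => Num.max t a) = fun t => Num.max (t - a) 0 + a.
  by apply/funext => s; rewrite addr_maxl subrK add0r.
apply: cvgD; last exact: cvg_cst.
apply: (@continuous_comp _ _ _ (fun t : R => t - a) (fun t : R => Num.max t 0)).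
  by apply: cvgB; [exact: cvg_id|exact: cvg_cst].
exact: continuous_max0.
Qed.

Lemma antiderivative (h : R -> R) : continuous h ->
  exists2 H : R -> R, H 0 = 0 & forall t : R, 0 <= t -> is_derive t (1 : R) H (h t).
Proof.
(* Integrating from -1 makes 0 an interior point, so the derivative there is two-sided. *)
move=> ch; pose F t : R := (\int[lebesgue_measure]_(s in [set` `[(-1 : R), t]]) (h s))%R.
exists (fun t => F t - F 0); first by rewrite subrr.
move=> t t0; have [] := @continuous_FTC1_closed R h (-1) t (t + 1) _ _ _ _.
- by rewrite ltrDl.
- apply: continuous_compact_integrable; first exact: segment_compact.
  exact: continuous_subspaceT.
- by lra.
- exact: ch.
rewrite -/F derive1E => dF F'.
have dFt : is_derive t (1 : R) F (h t) by apply: DeriveDef.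
have := is_deriveB dFt (is_derive_cst (F 0) t 1).
by rewrite subr0.
Qed.

(** The intervals of radius [B / 2 ^+ k] around [u k] are nested, and the supremum of their left
    ends lies in all of them. *)
Lemma nested_limit (u : nat -> R) (B : R) :
  (forall k, `|u k.+1 - u k| <= B / 2 ^+ k.+1) ->
  exists l, forall k, `|l - u k| <= B / 2 ^+ k.
Proof.
move=> hu; pose a k := u k - B / 2 ^+ k; pose b k := u k + B / 2 ^+ k.
have half k : B / 2 ^+ k.+1 = B / 2 ^+ k / 2.
  by rewrite exprS invfM; lra.
have aS k : a k <= a k.+1.
  by have := hu k; rewrite /a half ler_norml; lra.
have bS k : b k.+1 <= b k.
  by have := hu k; rewrite /b half ler_norml; lra.
have am k m : (k <= m)%N -> a k <= a m.
  elim: m => [|m ih]; first by rewrite leqn0 => /eqP ->.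
  by rewrite leq_eqVlt => /orP[/eqP ->//|/ih/le_trans]; apply.
have bm k m : (k <= m)%N -> b m <= b k.
  elim: m => [|m ih]; first by rewrite leqn0 => /eqP ->.
  by rewrite leq_eqVlt => /orP[/eqP ->//|/ih]; apply: le_trans.
have B0 : 0 <= B.
  by have := le_trans (normr_ge0 _) (hu 0); rewrite expr1; lra.
have ab k : a k <= b k.
  have : 0 <= B / 2 ^+ k by rewrite divr_ge0// exprn_ge0.
  by rewrite /a /b; lra.
have abm k m : a k <= b m.
  have [h|/ltnW h] := leqP k m.
    exact: le_trans (am _ _ h) (ab m).
  exact: le_trans (ab k) (bm _ _ h).
have nea : [set a k | k in setT] !=set0 by exists (a 0); exists 0.
exists (sup [set a k | k in setT]) => k.
have : a k <= sup [set a k | k in setT].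
  apply: ub_le_sup; last by exists k.
  by exists (b 0) => _ [m _ <-].
have : sup [set a k | k in setT] <= b k by apply: ge_sup => // _ [m _ <-].
by rewrite /a /b ler_norml; lra.
Qed.

Lemma small_halves (B e : R) : 0 < e -> exists k, B / 2 ^+ k < e.
Proof.
move=> e0; have := Num.Theory.archi_boundP (normr_ge0 (B / e)).
set k := Num.bound _ => hk; exists k.
rewrite ltr_pdivrMr ?exprn_gt0// mulrC -ltr_pdivrMr//.
apply: le_lt_trans (ler_norm _) _; apply: lt_trans hk _.
by rewrite -natrX ltr_nat ltn_expl.
Qed.

Variable n : nat.
Notation V := 'rV[R]_n.

(** The function [C * expR (K * t)] has a derivative dominating [|d t|], so by the mean value
    theorem its difference with [u_i] or [- u_i] never falls below its initial value [C]. *)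
Lemma exp_growth_bound (u d : R -> V) (C K : R) : 0 <= C -> 0 <= K ->
  continuous u -> (forall t : R, t <= 0 -> u t = 0) ->
  (forall t : R, 0 < t -> is_derive t (1 : R) u (d t)) ->
  (forall t : R, 0 < t -> `|d t| <= C * K * expR (K * t)) ->
  forall t, `|u t| <= C * expR (K * t).
Proof.
move=> C0 K0 cu u0 du hd t.
have Cexp s : 0 <= C * expR (K * s) by rewrite mulr_ge0// expR_ge0.
have [t0|t0] := leP t 0; first by rewrite u0// normr0.
apply: norm_le_coord => // i.
have dexp (s : R) : is_derive s (1 : R) (fun s => C * expR (K * s)) (C * K * expR (K * s)).
  have dK : is_derive s (1 : R) (fun s => K * s) K.
    by apply: is_derive_eq; rewrite /= scaler1 ?mulr1.
  have dE := @is_derive1_comp R expR (fun s => K * s) s _ _ (is_derive_expR _) dK.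
  apply: (@is_derive_eq _ _ _ (C \*: (expR \o (fun s => K * s))) s 1 _ _ _).
  by rewrite /= /GRing.scale/=; ring.
suff H (sg : R) : `|sg| = 1 -> sg * u t ord0 i <= C * expR (K * t).
  have := H 1 (normr1 _); have := H (-1) (normrN1 _); rewrite ler_norml; lra.
move=> sg1; pose psi s := C * expR (K * s) - sg * u s ord0 i.
have dpsi (s : R) : 0 < s -> is_derive s (1 : R) psi (C * K * expR (K * s) - sg * d s ord0 i).
  by move=> s0; have dui := @is_derive_coord _ _ u _ _ i (du s s0); apply: is_deriveB.
have cpsi : continuous psi.
  move=> s; apply: cvgB; first exact: is_derive_continuous (dexp s).
  apply: cvgM; first exact: cvg_cst.
  apply: (@continuous_comp _ _ _ u (fun v => v ord0 i)); first exact: cu.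
  exact: coord_continuous.
have [||s] := MVT t0 (df := fun s => C * K * expR (K * s) - sg * d s ord0 i) (f := psi).
- by move=> s; rewrite in_itv/= => /andP[s0 _]; exact: dpsi.
- exact: continuous_subspaceT.
rewrite in_itv/= => /andP[s0 st] E.
have hds : sg * d s ord0 i <= C * K * expR (K * s).
  apply: le_trans (ler_norm _) _; rewrite normrM sg1 mul1r.
  exact: le_trans (coord_le_norm _ _) (hd s s0).
have psi0 : psi 0 = C by rewrite /psi u0// mxE !mulr0 subr0 expR0 mulr1.
suff : 0 <= psi t by rewrite subr_ge0.
have : 0 <= psi t - psi 0 by rewrite E subr0 mulr_ge0 ?(ltW t0)// subr_ge0.
by rewrite psi0; lra.
Qed.

Variables (phi : R -> V) (F : V -> V -> V) (tau L M : R).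
Hypothesis tau0 : 0 <= tau.
Hypothesis cphi : continuous phi.
Hypothesis phi_cst : forall t : R, 0 <= t -> phi t = phi 0.
Hypothesis L0 : 0 <= L.
Hypothesis lipF : forall a b a' b',
  `|F a b - F a' b'| <= L * (`|a - a'| + `|b - b'|).
Hypothesis M0 : 0 <= M.
Hypothesis F_bounded : forall a b, `|F a b| <= M.

Lemma continuous_rhs (x : R -> V) : continuous x ->
  continuous (fun t => F (x t) (x (t - tau))).
Proof.
move=> cx t; apply/cvgrPdist_lt => e e0.
(* The summand 1 allows the division when [L = 0]. *)
have L1 : 0 < 2 * L + 1 by have := L0; lra.
have ed : 0 < e / (2 * L + 1) by rewrite divr_gt0.
have cxt : {for t, continuous (fun s => x (s - tau))}.
  apply: (@continuous_comp _ _ _ (fun s => s - tau) x); last exact: cx.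
  by apply: cvgB; [exact: cvg_id|exact: cvg_cst].
near=> s; apply: le_lt_trans (lipF _ _ _ _) _.
have h1 : `|x t - x s| < e / (2 * L + 1).
  by near: s; apply: cvgr_dist_lt => //; exact: cx.
have h2 : `|x (t - tau) - x (s - tau)| < e / (2 * L + 1).
  by near: s; apply: cvgr_dist_lt => //; exact: cxt.
have : (2 * L + 1) * (e / (2 * L + 1)) = e by rewrite mulrC divfK// gt_eqF.
have := ler_wpM2l L0 (lerD (ltW h1) (ltW h2)).
have := ed; set q := e / _; lra.
Unshelve. all: by end_near. Qed.

(* The right-hand side is frozen along [x]; the solutions are the fixpoints
   [picard_next x x]. *)
Definition picard_next (x y : R -> V) :=
  [/\ continuous y, (forall t : R, t <= 0 -> y t = phi t) &
      (forall t : R, 0 < t -> is_derive t (1 : R) y (F (x t) (x (t - tau))))].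

Lemma picard_next_exists x : continuous x -> exists y, picard_next x y.
Proof.
move=> cx; have ch := continuous_rhs cx.
have /choice[H HP] : forall i : 'I_n, exists Hi : R -> R, Hi 0 = 0 /\
    forall t : R, 0 <= t -> is_derive t (1 : R) Hi (F (x t) (x (t - tau)) ord0 i).
  move=> i.
  have [|Hi Hi0 dHi] := @antiderivative (fun t => F (x t) (x (t - tau)) ord0 i).
    move=> t; apply: (@continuous_comp _ _ _ _ (fun v : V => v ord0 i)); first exact: ch.
    exact: coord_continuous.
  by exists Hi.
(* The integral term vanishes for [t <= 0], where only the history remains; for [t >= 0] the history
   is the constant [phi 0]. *)
exists (fun t => phi t + \row_i H i (Num.max t 0)); split.
- move=> t; apply: cvgD; first exact: cphi.
  apply/cvgrPdist_le => e e0.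
  have : \forall s \near t, forall i : 'I_n,
      `|H i (Num.max t 0) - H i (Num.max s 0)| <= e.
    refine (@filter_forall _ _ (fun (i : 'I_n) s =>
      `|H i (Num.max t 0) - H i (Num.max s 0)| <= _) _ (nbhs_filter t) _) => i.
    have hc : {for t, continuous (H i \o (fun s : R => Num.max s 0))}.
      apply: continuous_comp; first exact: continuous_max0.
      apply: is_derive_continuous; apply: (HP i).2.
      by rewrite le_max lexx orbT.
    by apply: cvgr_dist_le => //; exact: hc.
  apply: filterS => s hs; apply: norm_le_coord; first exact: ltW.
  by move=> i; rewrite !mxE.
- move=> t t0; rewrite max_r// [X in _ + X](_ : _ = 0) ?addr0//.
  by apply/rowP => i; rewrite !mxE (HP i).1.
- move=> t t0; apply: coord_is_derive => i.
  apply: (@near_eq_is_derive _ _ _ (cst (phi 0 ord0 i) + H i)).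
    near=> s; have s0 : 0 < s by near: s; exact: lt_nbhsr.
    by rewrite !fctE !mxE max_l ?ltW// phi_cst ?ltW.
  have := is_deriveD (is_derive_cst (phi 0 ord0 i) t 1) ((HP i).2 t (ltW t0)).
  by rewrite add0r.
Unshelve. all: by end_near. Qed.

(** In the norm weighted by [expR (- K * t)], the right-hand side has Lipschitz constant [2 * L],
    the delay only helping, and integration gains a factor [1 / K]; hence the ratio 1/2 when
    [K >= 4 * L]. *)
Lemma picard_contraction (x x' y y' : R -> V) (C K : R) :
  0 <= C -> 4 * L <= K -> picard_next x y -> picard_next x' y' ->
  (forall t, `|x t - x' t| <= C * expR (K * t)) ->
  forall t, `|y t - y' t| <= C / 2 * expR (K * t).
Proof.
move=> C0 LK [cy y0 dy] [cy' y'0 dy'] hx.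
have K0 : 0 <= K by have := L0; lra.
apply: (@exp_growth_bound _
  (fun t => F (x t) (x (t - tau)) - F (x' t) (x' (t - tau)))) => //.
- by rewrite divr_ge0.
- by move=> t; apply: cvgB; [exact: cy|exact: cy'].
- by move=> t t0; rewrite y0// y'0// subrr.
- by move=> t t0; apply: is_deriveB; [exact: dy|exact: dy'].
move=> t t0; apply: le_trans (lipF _ _ _ _) _.
have etau : expR (K * (t - tau)) <= expR (K * t).
  by rewrite ler_expR ler_wpM2l// gerBl.
have h1 := hx t; have h2 := le_trans (hx (t - tau)) (ler_wpM2l C0 etau).
have := ler_wpM2l L0 (lerD h1 h2).
have Ce : 0 <= C * expR (K * t) by rewrite mulr_ge0// expR_ge0.
have := ler_wpM2r Ce LK.
set E := expR _ in Ce *; lra.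
Qed.

(** The convergence is uniform on each half-line bounded above; near [t] the weight is at most
    [expR (K * (t + 1))]. *)
Lemma continuous_exp_limit (X : nat -> R -> V) (x : R -> V) (B K : R) :
  0 <= B -> 0 <= K -> (forall k, continuous (X k)) ->
  (forall t k, `|x t - X k t| <= B * expR (K * t) / 2 ^+ k) -> continuous x.
Proof.
move=> B0 K0 cX hx t; apply/cvgrPdist_lt => e e0.
have e3 : 0 < e / 3 by rewrite divr_gt0.
have [k hk] := small_halves (B * expR (K * (t + 1))) e3.
near=> s.
have st : s <= t + 1 by apply: ltW; near: s; apply: lt_nbhsl; lra.
have hX : `|X k t - X k s| < e / 3.
  by near: s; apply: cvgr_dist_lt => //; exact: cX.
have near_k r : r <= t + 1 -> `|x r - X k r| < e / 3.
  move=> rt; apply: le_lt_trans (hx r k) (le_lt_trans _ hk).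
  by rewrite ler_wpM2r ?invr_ge0 ?exprn_ge0// ler_wpM2l// ler_expR ler_wpM2l.
have h1 := near_k _ st; have h2 : `|x t - X k t| < e / 3 by apply: near_k; lra.
have -> : x t - x s = (x t - X k t) + (X k t - X k s) - (x s - X k s).
  by apply/rowP => i; rewrite !mxE; ring.
apply: le_lt_trans (ler_normB _ _) _.
by have := ler_normD (x t - X k t) (X k t - X k s); lra.
Unshelve. all: by end_near. Qed.

Lemma picard_fixpoint : exists x, picard_next x x.
Proof.
(* [N] is a total Picard operator, unspecified on discontinuous functions. *)
have /choice[N HN] : forall x, exists y, continuous x -> picard_next x y.
  move=> x; have [cx|ncx] := pselect (continuous x); last by exists x.
  by have [y Hy] := picard_next_exists cx; exists y.
pose X k := iter k N phi.
have cX k : continuous (X k).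
  by elim: k => [//|k ih] /=; have [] := HN _ ih.
have stepX k : picard_next (X k) (X k.+1) by exact: HN.
(* [B / 2 * K = M], so the bound [M] on [F] controls the first iteration step. *)
pose K := 4 * L + 1; pose B := 2 * M / K.
have K1 : 0 < K by have := L0; rewrite /K; lra.
have LK : 4 * L <= K by rewrite /K; lra.
have B0 : 0 <= B by rewrite divr_ge0 ?mulr_ge0// ltW.
have pw k : 0 <= B / 2 ^+ k by rewrite divr_ge0// exprn_ge0.
have dX k : forall t, `|X k.+1 t - X k t| <= B / 2 ^+ k.+1 * expR (K * t).
  elim: k => [|k ih]; last first.
    move=> t; rewrite [2 ^+ k.+2]exprSr invfM mulrA.
    exact: (picard_contraction _ LK (stepX k.+1) (stepX k)).
  have [cX1 X10 dX1] := stepX 0.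
  apply: (@exp_growth_bound _ (fun t => F (phi t) (phi (t - tau)))) => //.
  - exact: ltW.
  - by move=> t; apply: cvgB; [exact: cX1|exact: cphi].
  - by move=> t t0; rewrite X10// subrr.
  - move=> t t0; have dphi : is_derive t (1 : R) phi 0.
      apply: (near_eq_is_derive _ (is_derive_cst (phi 0) t 1)).
      near=> s; have s0 : 0 < s by near: s; exact: lt_nbhsr.
      by rewrite -(phi_cst (ltW s0)).
    by have := is_deriveB (dX1 t t0) dphi; rewrite subr0.
  move=> t t0; apply: le_trans (F_bounded _ _) _.
  have -> : B / 2 ^+ 1 * K = M by rewrite /B expr1; field; rewrite gt_eqF.
  by rewrite ler_peMr// -expR0 ler_expR mulr_ge0 ?ltW.
have /choice[x hx] : forall t, exists v : V, forall k,
    `|v - X k t| <= B * expR (K * t) / 2 ^+ k.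
  move=> t; have /choice[v hv] : forall i, exists l, forall k,
      `|l - X k t ord0 i| <= B * expR (K * t) / 2 ^+ k.
    move=> i; apply: nested_limit => k; have := coord_le_norm (X k.+1 t - X k t) i.
    by rewrite !mxE => /le_trans; apply; rewrite mulrAC.
  exists (\row_i v i) => k; apply: norm_le_coord => [|i]; last by rewrite !mxE.
  by rewrite mulrAC mulr_ge0// expR_ge0.
have cx := continuous_exp_limit B0 (ltW K1) cX hx.
(* Both [x] and [N x] are close to the iterate [X k.+1], which gives [|x t - N x t| <= B * expR (K *
   t) / 2 ^+ k] for every [k]. *)
exists x; suff {2}-> : x = N x by exact: HN.
apply/funext => t; apply/eqP; rewrite -subr_eq0 -normr_le0 leNgt; apply/negP.
move=> /(small_halves (B * expR (K * t)))[k]; apply/negP; rewrite -leNgt.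
have h1 : `|N x t - X k.+1 t| <= B / 2 ^+ k / 2 * expR (K * t).
  apply: (picard_contraction _ LK (HN _ cx) (stepX k)) => // s.
  by rewrite mulrAC.
have h2 := hx t k.+1.
have -> : x t - N x t = (x t - X k.+1 t) - (N x t - X k.+1 t).
  by apply/rowP => i; rewrite !mxE; ring.
apply: le_trans (ler_normB _ _) (le_trans (lerD h2 h1) _).
by rewrite exprSr invfM; lra.
Unshelve. all: by end_near. Qed.

End Picard.

(** * Invariant boxes and uniqueness *)

Section Barrier.
Context {R : realType}.
Variables (u d : R -> R) (c : R).

Lemma last_crossing a b : a <= b -> continuous u -> u a <= c -> c < u b ->
  exists2 s, a <= s < b & u s <= c /\ forall t, s < t <= b -> c < u t.
Proof.
move=> ab cu ua ub; pose A := [set t | a <= t <= b /\ u t <= c].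
have Aa : A a by rewrite /A/= lexx ab.
have ubA : ubound A b by move=> t [/andP[]].
have hA : has_sup A by split; [exists a|exists b].
have sa : a <= sup A by apply: ub_le_sup => //; exists b.
have sb : sup A <= b by apply: ge_sup => //; exists a.
have us : u (sup A) <= c.
  rewrite leNgt; apply/negP => cs.
  have : \forall t \near sup A, c < u t by exact: (cvgr_gt _ (cu (sup A))).
  move=> /nbhs_ballP[r /= r0 hr].
  have [t At st] := sup_adherent r0 hA.
  have : c < u t.
    apply: hr; rewrite -ball_normE/= ger0_norm; first lra.
    by rewrite subr_ge0; apply: ub_le_sup => //; exists b.
  by case: At => _; rewrite leNgt => /negP.
exists (sup A); last first.
  split=> // t /andP[st tb]; rewrite ltNge; apply/negP => tc.
  have : t <= sup A.
    by apply: ub_le_sup; [exists b|split=> //; rewrite tb andbT; lra].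
  by rewrite leNgt st.
rewrite sa lt_neqAle sb andbT; apply/eqP => e.
by move: us; rewrite e leNgt ub.
Qed.

Hypothesis cu : continuous u.

(** After its last crossing of [c] the function would stay above [c], where its derivative is
    nonpositive, so it could not end above [c]. *)
Lemma barrier a b : a <= b -> u a <= c ->
  (forall t, a < t <= b -> is_derive t (1 : R) u (d t)) ->
  (forall t, a < t <= b -> c < u t -> d t <= 0) -> u b <= c.
Proof.
move=> ab ua du dle; rewrite leNgt; apply/negP => cub.
have [s /andP[as_ sb] [us ut]] := last_crossing ab cu ua cub.
have [t||] := MVT sb (f := u) (df := d).
- rewrite in_itv/= => /andP[st tb]; apply: du; rewrite (ltW tb) andbT; lra.
- exact: continuous_subspaceT.
move=> t; rewrite in_itv/= => /andP[st tb] E.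
have dt : d t <= 0.
  by apply: dle; [rewrite (ltW tb) andbT; lra|apply: ut; rewrite st ltW].
have : d t * (b - s) <= 0 by rewrite mulr_le0_ge0// subr_ge0 ltW.
lra.
Qed.

Lemma eventually_below (T eta : R) : 0 < eta ->
  (forall t, T < t -> is_derive t (1 : R) u (d t)) ->
  (forall t, T < t -> c < u t -> d t <= - eta) ->
  \forall t \near pinfty_nbhs R, u t <= c.
Proof.
move=> eta0 du dle.
suff [s Ts us] : exists2 s, T <= s & u s <= c.
  near=> t; have st : s <= t by near: t; exact: (nbhs_pinfty_ge (num_real _)).
  apply: (barrier st us) => r /andP[sr _]; first by apply: du; lra.
  by move=> cr; have := dle r (le_lt_trans Ts sr) cr; lra.
have [uT|cT] := leP (u T) c; first by exists T.
(* Descending at rate at least [eta], [u] must reach [c] by time [b]; [barrier] keeps it below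
   afterwards. *)
pose b := T + (u T - c) / eta.
have Tb : T < b by rewrite ltrDl divr_gt0// subr_gt0.
have [ub|cb] := leP (u b) c; first by exists b => //; exact: ltW.
have [[s /andP[Ts _] us]|ns] := pselect (exists2 s, T <= s <= b & u s <= c).
  by exists s.
have [t||] := MVT Tb (f := u) (df := d).
- by rewrite in_itv/= => /andP[Tt _]; exact: du.
- exact: continuous_subspaceT.
move=> t; rewrite in_itv/= => /andP[Tt tb] E.
have ct : c < u t.
  by rewrite ltNge; apply/negP => ut; apply: ns; exists t => //; rewrite !ltW.
have := ler_wpM2r (ltW (etrans (subr_gt0 _ _) Tb)) (dle t Tt ct).
rewrite -E {2}/b (addrC T) addrK mulNr mulrCA divff ?gt_eqF// mulr1; lra.
Unshelve. all: by end_near. Qed.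

End Barrier.

(** * Projection onto a box *)

Section Clip.
Context {R : realType} {n : nat}.
Notation V := 'rV[R]_n.
Implicit Types W x y : V.

Definition clip W x : V := \row_i Num.min (Num.max (x ord0 i) 0) (W ord0 i).

Lemma box_clip W x : nonneg W -> box W (clip W x).
Proof.
by move=> W0; apply/boxP => i; rewrite mxE le_min W0 le_max lexx orbT ge_min lexx orbT.
Qed.

Lemma clip_id W x : box W x -> clip W x = x.
Proof.
move=> /boxP xW; apply/rowP => i; have /andP[x0 xw] := xW i.
by rewrite mxE max_l// min_l.
Qed.

Lemma clip_le0 W x i : nonneg W -> x ord0 i <= 0 -> clip W x ord0 i = 0.
Proof. by move=> W0 x0; rewrite mxE max_r// min_l. Qed.

Lemma clip_geW W x i : nonneg W -> W ord0 i <= x ord0 i -> clip W x ord0 i = W ord0 i.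
Proof. by move=> W0 xW; rewrite mxE min_r// le_max xW. Qed.

Lemma clip_contract W x y : `|clip W x - clip W y| <= `|x - y|.
Proof.
apply: norm_le_coord => // i; apply: le_trans (coord_le_norm _ i); rewrite !mxE.
have := ler_norm (x ord0 i - y ord0 i); have := ler_norm (y ord0 i - x ord0 i).
rewrite (distrC (y ord0 i)) => ? ?; rewrite ler_norml.
rewrite /Order.min /Order.max.
by case: (ltP (x ord0 i) 0) => ?; case: (ltP (y ord0 i) 0) => ?;
  repeat (case: ltP => ?); lra.
Qed.

End Clip.

(** * Solutions confined to a box, and uniqueness *)

Section Invariance.
Context {R : realType} {n : nat}.
Notation V := 'rV[R]_n.
Variables (f g : V -> V) (tau : R) (phi : R -> V).

Definition rhs (a b : V) := f a + g b.

Lemma continuous_coord (x : R -> V) i : continuous x ->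
  continuous (fun t => x t ord0 i).
Proof.
move=> cx t; apply: (@continuous_comp _ _ _ x (fun v : V => v ord0 i)); first exact: cx.
exact: coord_continuous.
Qed.

(** Outside the box the clipped state lies on the corresponding face: on the lower one the sign
    conditions push [x_i] up, on the upper one [decay] pushes it down. Both cases are instances of
    [barrier]. *)
Lemma clipped_in_box (W : V) (e : R) (x : R -> V) : nonneg W -> 0 <= e ->
  (forall x i, nonneg x -> x ord0 i = 0 -> 0 <= f x ord0 i) ->
  (forall x i, nonneg x -> 0 <= g x ord0 i) ->
  decay f g W e -> (forall t, box W (phi t)) ->
  picard_next phi (fun a b => rhs (clip W a) (clip W b)) tau x x ->
  forall t, box W (x t).
Proof.
move=> W0 e0 f0 g0 dW phiW [cx xphi dx] t.
have [t0|t0] := leP t 0; first by rewrite xphi.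
have cnn a : nonneg (clip W a) by move=> i; have /boxP/(_ i)/andP[] := box_clip a W0.
have x00 i : 0 <= x 0 ord0 i <= W ord0 i by rewrite xphi//; have /boxP := phiW 0; exact.
apply/boxP => i; apply/andP; split.
- rewrite -oppr_le0.
  apply: (@barrier _ (fun s => - x s ord0 i) (fun s =>
    - rhs (clip W (x s)) (clip W (x (s - tau))) ord0 i) _ _ 0).
  + by move=> s; apply: cvgN; exact: continuous_coord.
  + exact: ltW.
  + by have /andP[] := x00 i; rewrite oppr_le0.
  + move=> s /andP[s0 _]; apply: is_deriveN; exact: is_derive_coord (dx s s0).
  + move=> s _; rewrite oppr_gt0 => xs; rewrite oppr_le0 mxE addr_ge0 ?g0//.
    by apply: f0 => //; rewrite clip_le0// ltW.
- apply: (@barrier _ (fun s => x s ord0 i) (fun s =>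
    rhs (clip W (x s)) (clip W (x (s - tau))) ord0 i) _ _ 0).
  + exact: continuous_coord.
  + exact: ltW.
  + by have /andP[] := x00 i.
  + move=> s /andP[s0 _]; exact: is_derive_coord (dx s s0).
  + move=> s _ xs; rewrite mxE.
    have := dW i _ _ (box_clip (x s) W0) (box_clip (x (s - tau)) W0).
    by move=> /(_ (clip_geW W0 (ltW xs))); lra.
Qed.

(** Clipping turns Lipschitz bounds on the box into a globally Lipschitz and bounded right-hand
    side, as Picard iteration requires. *)
Lemma clipped_solution_exists (W : V) (L : R) : nonneg W -> 0 <= tau ->
  continuous phi -> (forall t, 0 <= t -> phi t = phi 0) ->
  0 <= L -> lipschitz_on (box W) f L -> lipschitz_on (box W) g L ->
  exists x, picard_next phi (fun a b => rhs (clip W a) (clip W b)) tau x x.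
Proof.
move=> W0 tau0 cphi phic L0 lf lg.
pose F a b := rhs (clip W a) (clip W b).
have lipF a b a' b' : `|F a b - F a' b'| <=
    L * (`|clip W a - clip W a'| + `|clip W b - clip W b'|).
  apply: norm_le_coord => [|i]; first by rewrite mulr_ge0// addr_ge0.
  have := lf _ _ (box_clip a W0) (box_clip a' W0) i.
  have := lg _ _ (box_clip b W0) (box_clip b' W0) i.
  rewrite !mxE !ler_norml; lra.
have clipW a : `|clip W a - clip W 0| <= `|W|.
  apply: norm_le_coord => // i; apply: le_trans (coord_le_norm _ i).
  have -> : (clip W a - clip W 0) ord0 i = clip W a ord0 i.
    rewrite [LHS]mxE [X in _ + X]mxE (@clip_le0 _ _ W 0) ?subr0//.
    by rewrite mxE.
  have /boxP/(_ i)/andP[c0 cW] := box_clip a W0.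
  by rewrite !ger0_norm.
apply: (@picard_fixpoint _ _ phi F tau L (`|F 0 0| + L * (`|W| + `|W|))) => //.
- move=> a b a' b'; apply: le_trans (lipF _ _ _ _) _; rewrite ler_wpM2l// lerD//;
  exact: clip_contract.
- by rewrite addr_ge0// mulr_ge0// addr_ge0.
- move=> a b; rewrite -[F a b](subrK (F 0 0)) addrC.
  apply: le_trans (ler_normD _ _) _; rewrite lerD2l.
  by apply: le_trans (lipF _ _ _ _) _; rewrite ler_wpM2l// lerD.
Qed.

(** If the solutions differ somewhere, let [T] be the supremum of the times up to which they agree.
    The local Lipschitz bounds at [y T] and [y (T - tau)] extend the agreement beyond [T]. *)
Lemma solution_unique (D : set V) (x y : R -> V) : open D -> 0 <= tau ->
  C1_on D f -> C1_on D g -> (forall t, D (y t)) ->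
  picard_next phi rhs tau x x -> picard_next phi rhs tau y y -> x = y.
Proof.
move=> oD tau0 Cf Cg Dy [cx xphi dx] [cy yphi dy].
apply/funext => b; apply/eqP; apply/negPn/negP => /eqP xyb.
pose A := [set t | 0 <= t /\ forall s, s <= t -> x s = y s].
have A0 : A 0 by split=> // s s0; rewrite xphi// yphi.
have ubA : ubound A b.
  by move=> t [_ h]; rewrite leNgt; apply/negP => bt; apply: xyb; apply: h; exact: ltW.
have hA : has_sup A by split; [exists 0|exists b].
set T := sup A.
have T0 : 0 <= T by apply: ub_le_sup => //; exists b.
have eqlt s : s < T -> x s = y s.
  move=> sT; have sT0 : 0 < T - s by rewrite subr_gt0.
  by have [t [_ ht]] := sup_adherent sT0 hA; rewrite -/T => ?; apply: ht; lra.
have cxy : continuous (fun t => x t - y t).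
  by move=> t; apply: cvgB; [exact: cx|exact: cy].
have eqT : x T = y T.
  apply/eqP; rewrite -subr_eq0 -normr_le0 leNgt; apply/negP => h.
  have : \forall s \near T, 0 < `|x s - y s|.
    by apply: (cvgr_norm_gt _ (cxy T)).
  move=> /nbhs_ballP[r /= r0 hr].
  have : 0 < `|x (T - r / 2) - y (T - r / 2)|.
    by apply: hr; rewrite -ball_normE/= gtr0_norm; lra.
  by rewrite eqlt ?subrr ?normr0 ?ltxx//; lra.
have eqle s : s <= T -> x s = y s.
  by rewrite le_eqVlt => /orP[/eqP ->//|]; exact: eqlt.
have [L1 L10 [r1 r10 lf]] := C1_locally_lipschitz oD Cf (Dy T).
have [L2 L20 [r2 r20 lg]] := C1_locally_lipschitz oD Cg (Dy (T - tau)).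
have tail z : continuous z -> {for T, continuous (fun s => z (s - tau) : V)}.
  move=> cz; apply: (@continuous_comp _ _ _ (fun s : R => s - tau) z); last exact: cz.
  by apply: cvgB; [exact: cvg_id|exact: cvg_cst].
have near_balls : \forall s \near T, [/\ ball (y T) r1 (x s), ball (y T) r1 (y s),
    ball (y (T - tau)) r2 (x (s - tau)) & ball (y (T - tau)) r2 (y (s - tau))].
  near=> s; split.
  - by near: s; rewrite -eqT; exact: (cvg_ball (cx T)).
  - by near: s; exact: (cvg_ball (cy T)).
  - near: s; rewrite -(eqle (T - tau)); last lra.
    exact: (cvg_ball (tail _ cx)).
  - by near: s; exact: (cvg_ball (tail _ cy)).
move: near_balls => /nbhs_ballP[r /= r0 hr].
pose L := L1 + L2; have L0 : 0 <= L by exact: addr_ge0.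
(* [h <= r / 2] keeps the times in the neighbourhood just found, and [h * L < 1] makes
   [m <= h * (L * m)] force [m = 0]. *)
pose h := Num.min (r / 2) (1 / (2 * L + 2)).
have L2p : 0 < 2 * L + 2 by lra.
have h0 : 0 < h by rewrite lt_min !divr_gt0.
have hr2 : h <= r / 2 by rewrite ge_min lexx.
have hL : h * (2 * L + 2) <= 1 by rewrite -ler_pdivlMr// ge_min lexx orbT.
have [||c] := @EVT_max R (fun t => `|x t - y t|) T (T + h).
- lra.
- apply: continuous_subspaceT => t; apply: cvg_norm; exact: cxy.
rewrite in_itv/= => /andP[Tc ch] maxc.
set m := `|x c - y c| in maxc *.
have m0 : 0 <= m by exact: normr_ge0.
have mle s : s <= T + h -> `|x s - y s| <= m.
  move=> sh; have [sT|Ts] := leP s T; first by rewrite eqle// subrr normr0.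
  by apply: maxc; rewrite in_itv/= sh (ltW Ts).
suff m_eq : m <= h * (L * m).
  have mz : m <= 0 by nra.
  have : A (T + h).
    split=> [|s sh]; first lra.
    by apply/eqP; rewrite -subr_eq0 -normr_le0 (le_trans (mle s sh)).
  move=> /(ub_le_sup (ex_intro _ b ubA)); rewrite -/T; lra.
have [cT|cT] := leP c T.
  by rewrite /m (eqle c cT) subrr normr0 mulr_ge0 ?mulr_ge0// ltW.
apply: norm_le_coord => [|i]; first by rewrite mulr_ge0 ?mulr_ge0// ltW.
pose u t := x t ord0 i - y t ord0 i.
pose d t := rhs (x t) (x (t - tau)) ord0 i - rhs (y t) (y (t - tau)) ord0 i.
have [t||] := MVT cT (f := u) (df := d).
- rewrite in_itv/= => /andP[Tt tc]; have t0 : 0 < t by exact: le_lt_trans Tt.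
  by apply: is_deriveB; [exact: is_derive_coord (dx t t0)|exact: is_derive_coord (dy t t0)].
- apply: continuous_subspaceT => t.
  exact: (cvgB (@continuous_coord x i cx t) (@continuous_coord y i cy t)).
move=> t; rewrite in_itv/= => /andP[Tt tc].
have -> : u T = 0 by rewrite /u eqT subrr.
rewrite subr0 /u => E.
rewrite [(x c - y c) _ _]mxE [(- y c) _ _]mxE E normrM (ger0_norm (_ : 0 <= c - T)); last lra.
rewrite mulrC; apply: ler_pM => //; [lra|lra|].
have [b1 b2 b3 b4] : [/\ ball (y T) r1 (x t), ball (y T) r1 (y t),
    ball (y (T - tau)) r2 (x (t - tau)) & ball (y (T - tau)) r2 (y (t - tau))].
  by apply: hr; rewrite -ball_normE/= ltr0_norm; lra.
have := lf _ _ b1 b2 i; have := lg _ _ b3 b4 i.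
have := ler_wpM2l L10 (mle t (ltW (lt_le_trans tc ch))).
have := ler_wpM2l L20 (mle (t - tau) _).
rewrite /d !mxE /L mulrDl => /(_ _)/= M2 M1; rewrite !ler_norml.
have := M2 (ltac:(lra)); lra.
Unshelve. all: by end_near. Qed.

End Invariance.

(** * Contraction of boxes *)

Section Attraction.
Context {R : realType} {n : nat}.
Notation V := 'rV[R]_n.
Variables (f g : V -> V) (tau : R) (phi : R -> V).

(** Points of [box (lam *: v)] are [lam] times points of [box v], so subhomogeneity bounds the sum
    by [- (lam]^ alpha * e)[, and]lam [^ alpha >= 1]. *)
Lemma decay_scale (alpha e lam : R) (v : V) : 0 < alpha ->
  subhomogeneous alpha f -> subhomogeneous alpha g -> 0 <= e -> 1 <= lam ->
  decay f g v e -> decay f g (lam *: v) e.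
Proof.
move=> a0 sf sg e0 l1 dv i x y /boxP bx /boxP b_y xi.
have l0 : 0 < lam by lra.
have unscale (z : V) : (forall j, 0 <= z ord0 j <= (lam *: v) ord0 j) ->
    box v (lam^-1 *: z).
  move=> hz; apply/boxP => j; have /andP[z0 zl] := hz j; rewrite !mxE.
  apply/andP; split; first by rewrite mulr_ge0// invr_ge0 ltW.
  by move: zl; rewrite mxE => zl; rewrite mulrC ler_pdivrMr// mulrC.
have bx' := unscale x bx; have by' := unscale y b_y.
have nn (z : V) : box v z -> nonneg z by move=> /boxP bz j; have /andP[] := bz j.
have := sf lam _ l1 (nn _ bx') i; have := sg lam _ l1 (nn _ by') i.
rewrite !scalerA divff ?gt_eqF// !scale1r => hg hf.
have xi' : (lam^-1 *: x) ord0 i = v ord0 i.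
  by rewrite mxE xi mxE mulKf// gt_eqF.
have hd := dv i _ _ bx' by' xi'.
have p1 : 1 <= lam `^ alpha by rewrite -(powRr0 lam) ler_powR// ltW.
have := ler_wpM2l (le_trans ler01 p1) hd; rewrite mulrDr.
have : e <= lam `^ alpha * e by rewrite ler_peMl.
rewrite mulrN; lra.
Qed.

(** While [x_i > mu' * v_i], raising [x_i] to the face [mu * v_i] changes [f_i] by at most [e / 2];
    decay on that face therefore leaves [x_i] a derivative of at most [- e / 2]. *)
Lemma box_contraction (v : V) (e Lam L mu mu' : R) (x : R -> V) :
  nonneg v -> 0 <= tau -> 0 < e -> 0 <= L -> lipschitz_on (box (Lam *: v)) f L ->
  decay f g (mu *: v) e -> picard_next phi (@rhs _ _ f g) tau x x ->
  0 <= mu' -> mu' <= mu <= Lam -> (mu - mu') * (L * `|v|) <= e / 2 ->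
  (\forall t \near pinfty_nbhs R, box (mu *: v) (x t)) ->
  \forall t \near pinfty_nbhs R, box (mu' *: v) (x t).
Proof.
move=> v0 tau0 e0 L0 lf dmu [cx xphi dx] mu'0 /andP[mu'mu muL] small xmu.
have [T0 [_ hT0]] := xmu.
have below : \forall t \near pinfty_nbhs R, forall i : 'I_n, x t ord0 i <= mu' * v ord0 i.
  refine (@filter_forall _ _ (fun (i : 'I_n) t => x t ord0 i <= mu' * v ord0 i) _ _ _) => i.
  (* After [T] the delayed state is in the large box too, and [t] is positive. *)
  pose T := Num.max T0 0 + tau.
  have T0T : T0 + tau <= T by rewrite /T lerD2r le_max lexx.
  have T1 : 0 <= T by rewrite /T addr_ge0// le_max lexx orbT.
  apply: (@eventually_below _ (fun t => x t ord0 i)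
    (fun t => rhs f g (x t) (x (t - tau)) ord0 i) _ _ T (e / 2)).
  - exact: continuous_coord.
  - by rewrite divr_gt0.
  - move=> t Tt; apply: (is_derive_coord i (dx t _)); lra.
  move=> t Tt ct.
  have b1 : box (mu *: v) (x t) by apply: hT0; lra.
  have b2 : box (mu *: v) (x (t - tau)) by apply: hT0; lra.
  pose a : V := \row_j if j == i then mu * v ord0 i else x t ord0 j.
  have /boxP hb1 := b1.
  have ba : box (mu *: v) a.
    apply/boxP => j; have := hb1 j; rewrite !mxE; case: eqP => [->|//] _.
    by rewrite lexx andbT mulr_ge0// (le_trans mu'0).
  have wide z : box (mu *: v) z -> box (Lam *: v) z.
    move=> /boxP hz; apply/boxP => j; have /andP[-> /=] := hz j.
    by rewrite !mxE => /le_trans; apply; rewrite ler_wpM2r.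
  have ai : a ord0 i = (mu *: v) ord0 i by rewrite !mxE eqxx.
  have := dmu i _ _ ba b2 ai.
  have := lf _ _ (wide _ b1) (wide _ ba) i.
  have dist : `|x t - a| <= (mu - mu') * `|v|.
    apply: norm_le_coord => [|j]; first by rewrite mulr_ge0// subr_ge0.
    rewrite !mxE; case: eqP => [->|_]; last first.
      by rewrite subrr normr0 mulr_ge0// subr_ge0.
    have := hb1 i; rewrite mxE => /andP[_ hx].
    rewrite ler0_norm ?subr_le0// opprB.
    apply: (@le_trans _ _ ((mu - mu') * v ord0 i)); first by rewrite mulrBl lerD2l lerN2 ltW.
    by rewrite ler_wpM2l ?subr_ge0// (le_trans (ler_norm _))// coord_le_norm.
  have := ler_wpM2l L0 dist; rewrite mulrCA => h1.
  by rewrite [rhs _ _ _ _ _ _]mxE ler_norml => /andP[_ h2] h3; lra.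
apply: filterS2 xmu below => t /boxP h1 h2; apply/boxP => i.
by have /andP[-> _] := h1 i; rewrite mxE h2.
Qed.

(** The rate [e] is common to all [mu >= 1], so each contraction lowers [mu] by the same [d] and
    finitely many lead from [Lam] to 1. *)
Lemma eventually_in_box (v : V) (e Lam L : R) (x : R -> V) :
  nonneg v -> 0 <= tau -> 0 < e -> 0 <= L -> lipschitz_on (box (Lam *: v)) f L ->
  (forall mu, 1 <= mu -> decay f g (mu *: v) e) -> 1 <= Lam ->
  picard_next phi (@rhs _ _ f g) tau x x -> (forall t, box (Lam *: v) (x t)) ->
  \forall t \near pinfty_nbhs R, box v (x t).
Proof.
move=> v0 tau0 e0 L0 lf dv Lam1 sx xL.
have Lv0 : 0 <= L * `|v| by rewrite mulr_ge0.
pose d := e / (2 * (L * `|v|) + 1).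
have den : 0 < 2 * (L * `|v|) + 1 by lra.
have d0 : 0 < d by rewrite divr_gt0.
have dE : d * (2 * (L * `|v|) + 1) = e by rewrite divfK// gt_eqF.
pose mu k := Num.max (Lam - k%:R * d) 1.
have mu1 k : 1 <= mu k by rewrite le_max lexx orbT.
have step k : \forall t \near pinfty_nbhs R, box (mu k *: v) (x t).
  elim: k => [|k ih].
    by near=> t; rewrite /mu mul0r subr0 max_l.
  have muS : mu k.+1 <= mu k <= mu k.+1 + d.
    rewrite /mu -natr1 mulrDl mul1r.
    by case: (leP (Lam - k%:R * d) 1) => ?; case: (leP (Lam - _) 1) => ?; apply/andP; split; lra.
  have muL : mu k <= Lam.
    by rewrite ge_max Lam1 andbT gerBl mulr_ge0// ltW.
  have /andP[muS1 muS2] := muS.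
  apply: (@box_contraction v e Lam L (mu k)) => //.
  - exact: dv.
  - by have := mu1 k.+1; lra.
  - by rewrite muS1 muL.
  - by have := ler_wpM2r Lv0 (_ : mu k - mu k.+1 <= d) => /(_ (ltac:(lra))); lra.
have := step (Num.bound (Lam / d)).
have LN : Lam / d < (Num.bound (Lam / d))%:R.
  by apply: archi_boundP; rewrite divr_ge0 ?ltW//; lra.
rewrite /mu max_r ?scale1r//.
by move: LN; rewrite ltr_pdivrMr//; lra.
Unshelve. all: by end_near. Qed.

End Attraction.

(** * Stability *)

Section Extension.
Context {R : realType} {n : nat}.
Notation V := 'rV[R]_n.
Variables (f g : V -> V) (tau : R).
Hypothesis tau0 : 0 <= tau.

Lemma continuous_retract (A : set R) (rho : R -> R) (x : R -> V) :
  continuous rho -> (forall t, A (rho t)) -> {within A, continuous x} ->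
  continuous (x \o rho).
Proof.
move=> crho Arho /subspace_continuousP cx t.
have crt : rho s @[s --> t] --> within A (nbhs (rho t)).
  move=> B wB.
  have hB : nbhs t (fun s => A (rho s) -> B (rho s)) := crho t _ wB.
  rewrite /= /nbhs/=; apply: (filterS _ hB) => s; apply; exact: Arho.
exact: (cvg_comp _ _ crt (cx _ (Arho t))).
Qed.

(* Functions given on [- tau, 0] or [- tau, +oo[ are extended to the whole line by
   precomposition with a retraction, which dispenses with subspace topologies. *)
Definition retract (t : R) := Num.max (Num.min t 0) (- tau).

Lemma continuous_retract_fun : continuous retract.
Proof.
have c2 : continuous (fun t : R => Num.min t 0).
  move=> t; have -> : (fun t : R => Num.min t 0) = fun t => - Num.max (- t) 0.
    by apply/funext => s; rewrite oppr_max opprK oppr0.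
  apply: cvgN; apply: (@continuous_comp _ _ _ (fun t : R => - t) (fun t : R => Num.max t 0)).
    exact: cvgN.
  exact: continuous_max0.
move=> t; apply: (@continuous_comp _ _ _ (fun t : R => Num.min t 0)
  (fun t : R => Num.max t (- tau))); [exact: c2|exact: continuous_maxr].
Qed.

End Extension.

(** * Passage between the delay system and the whole time line *)

Section Solutions.
Context {R : realType} {n : nat}.
Notation V := 'rV[R]_n.
Variables (f g : V -> V) (tau : R).
Hypothesis tau0 : 0 <= tau.

Lemma retract_id t : - tau <= t <= 0 -> retract tau t = t.
Proof. by move=> /andP[t1 t2]; rewrite /retract min_l// max_l. Qed.

Lemma retract_in t : - tau <= retract tau t <= 0.
Proof. by rewrite /retract le_max lexx orbT ge_max ge_min lexx orbT oppr_le0. Qed.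

Lemma retract_ge0 t : 0 <= t -> retract tau t = 0.
Proof. by move=> t0; rewrite /retract min_r// max_l// oppr_le0. Qed.

Lemma continuous_initial (phi : R -> V) : init_data tau phi ->
  continuous (phi \o retract tau).
Proof.
move=> [cphi _]; apply: (@continuous_retract _ _ `[- tau, 0]) => //.
- exact: continuous_retract_fun.
- by move=> t; rewrite /= in_itv/= retract_in.
Qed.

Lemma initial_bounded (phi : R -> V) : init_data tau phi ->
  exists2 M, 0 <= M & forall t, `|phi (retract tau t)| <= M.
Proof.
move=> hphi; have cphi := continuous_initial hphi.
have [||c _ hc] := @EVT_max R (fun t => `|phi (retract tau t)|) (- tau) 0.
- by rewrite oppr_le0.
- apply: continuous_subspaceT => t; apply: cvg_norm; exact: cphi.
exists `|phi (retract tau c)| => // t.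
have := hc (retract tau t); rewrite in_itv/= retract_in => /(_ isT).
by rewrite (retract_id (retract_in t)).
Qed.

Lemma solution_extension (phi x : R -> V) : dde_solution f g tau phi x ->
  picard_next (phi \o retract tau) (@rhs _ _ f g) tau
    (fun t => x (Num.max t (- tau))) (fun t => x (Num.max t (- tau))).
Proof.
move=> [cx xphi dx]; split.
- apply: (@continuous_retract _ _ `[- tau, +oo[ (fun t => Num.max t (- tau))) => //.
    exact: continuous_maxr.
  by move=> t; rewrite /= in_itv/= le_max lexx orbT.
- move=> t t0; rewrite /= /retract (min_l t0) xphi//.
  by rewrite le_max lexx orbT ge_max t0 oppr_le0.
- move=> t t0; rewrite max_l; last by have := tau0; lra.
  rewrite max_l; last by rewrite lerBrDr addNr ltW.
  apply: near_eq_is_derive (dx t t0).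
  near=> s; rewrite max_l//; have s0 : 0 < s by near: s; exact: lt_nbhsr.
  by rewrite (le_trans _ (ltW s0))// oppr_le0.
Unshelve. all: by end_near. Qed.

Lemma solution_of_extension (phi x : R -> V) :
  picard_next (phi \o retract tau) (@rhs _ _ f g) tau x x ->
  dde_solution f g tau phi x.
Proof.
move=> [cx xphi dx]; split=> //; first exact: continuous_subspaceT.
by move=> s /andP[s0 s1]; rewrite xphi//= retract_id// s0.
Qed.

End Solutions.

(** * From small points of decay to global asymptotic stability *)

Section Main.
Context {R : realType} {n : nat}.
Notation V := 'rV[R]_n.
Variables (D : set V) (f g : V -> V).
Hypotheses (oD : open D) (DV : forall x, nonneg x -> D x).
Hypotheses (Cf : C1_on D f) (Cg : C1_on D g).

Lemma box_lipschitz (w : V) : exists L, [/\ 0 < L,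
  lipschitz_on (box w) f L & lipschitz_on (box w) g L].
Proof.
have boxD : box w `<=` D.
  by move=> x /boxP hx; apply: DV => i; have /andP[] := hx i.
have boxc : compact (box w).
  rewrite (_ : box w = [set x : V | forall i, 0 <= x ord0 i <= w ord0 i]).
    exact: (@box_compact _ _ (fun=> 0) (fun i => w ord0 i)).
  by apply/seteqP; split=> x /boxP.
have [L1 L10 lf] := C1_compact_lipschitz Cf boxD boxc (@segment_closed_box _ _ w).
have [L2 L20 lg] := C1_compact_lipschitz Cg boxD boxc (@segment_closed_box _ _ w).
exists (L1 + L2 + 1); split; first lra.
- move=> x y bx b_y i; apply: le_trans (lf _ _ bx b_y i) _.
  by rewrite ler_wpM2r//; lra.
- move=> x y bx b_y i; apply: le_trans (lg _ _ bx b_y i) _.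
  by rewrite ler_wpM2r//; lra.
Qed.

(** [sup] bounds a set only if the set is bounded above; the Lipschitz estimate on the box supplies
    this for both image sets. *)
Lemma sup_gap (w : V) (i : 'I_n) : nonneg w ->
  sup [set g y ord0 i | y in box w] <
    - sup [set f x ord0 i | x in [set x | box w x /\ x ord0 i = w ord0 i]] ->
  exists2 c, 0 < c & forall x y, box w x -> box w y -> x ord0 i = w ord0 i ->
    f x ord0 i + g y ord0 i <= - c.
Proof.
move=> w0; have [L [L0 lf lg]] := box_lipschitz w.
have bw : box w w by apply/boxP => j; rewrite w0 lexx.
have bound h : lipschitz_on (box w) h L ->
    forall x, box w x -> h x ord0 i <= h w ord0 i + L * `|w|.
  move=> lh x bx; have := lh _ _ bx bw i.
  have : `|x - w| <= `|w|.
    apply: norm_le_coord => // j; apply: le_trans (coord_le_norm _ j).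
    have /boxP/(_ j)/andP[x0 xw] := bx.
    by rewrite !mxE distrC !ger0_norm ?subr_ge0 ?w0// gerBl.
  move=> /(ler_wpM2l (ltW L0)) h1; rewrite ler_norml => /andP[_ h2]; lra.
set S1 := [set _ | _ in _]; set S2 := [set _ | _ in _] => hS.
exists (- (sup S1 + sup S2)); first lra.
move=> x y bx b_y xi; rewrite opprK addrC; apply: lerD; apply: ub_le_sup.
- by exists (g w ord0 i + L * `|w|) => _ [z bz <-]; exact: bound.
- by exists y.
- by exists (f w ord0 i + L * `|w|) => _ [z [bz _] <-]; exact: bound.
- by exists x.
Qed.

Hypothesis boundary : forall x i, nonneg x -> x ord0 i = 0 -> 0 <= f x ord0 i.
Hypothesis g_ge0 : forall x i, nonneg x -> 0 <= g x ord0 i.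
Variables (tau : R) (tau0 : 0 <= tau).

(** The clipped solution stays in the box, where clipping is the identity, so it solves the original
    system; uniqueness identifies every other solution with it. *)
Lemma decay_box_solution (W : V) (e : R) (phi : R -> V) :
  nonneg W -> 0 <= e -> decay f g W e -> init_data tau phi ->
  (forall t, box W (phi (retract tau t))) ->
  exists y, [/\ picard_next (phi \o retract tau) (@rhs _ _ f g) tau y y,
    forall t, box W (y t) &
    forall x, dde_solution f g tau phi x -> forall t, - tau <= t -> x t = y t].
Proof.
move=> W0 e0 dW hphi phiW; have [L [L0 lf lg]] := box_lipschitz W.
have [||y sy] := @clipped_solution_exists _ _ f g tau (phi \o retract tau)
  W L W0 tau0 _ _ (ltW L0) lf lg.
- exact: continuous_initial.
- by move=> t t0 /=; rewrite !retract_ge0.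
have yW := clipped_in_box W0 e0 boundary g_ge0 dW phiW sy.
have sy' : picard_next (phi \o retract tau) (@rhs _ _ f g) tau y y.
  have [cy yphi dy] := sy; split=> // t t0.
  by have := dy t t0; rewrite !clip_id.
have yD t : D (y t).
  by apply: DV => i; have /boxP/(_ i)/andP[] := yW t.
exists y; split=> // x /(solution_extension tau0) sx t ht.
have := solution_unique oD tau0 Cf Cg yD sx sy'.
by move=> /(congr1 (fun h => h t)); rewrite max_l.
Qed.

Lemma positive_lower_bound (v : V) : (forall i, 0 < v ord0 i) ->
  exists2 m, 0 < m & forall i, m <= v ord0 i.
Proof.
(* The default value 1 keeps the minimum positive when [n = 0]. *)
move=> v0; exists (\big[Num.min/1]_i v ord0 i).
  by apply: lt_bigmin => // i _.
by move=> i; exact: bigmin_le_cond.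
Qed.

Variable alpha : R.
Hypotheses (alpha0 : 0 < alpha) (sf : subhomogeneous alpha f)
  (sg : subhomogeneous alpha g).
Hypothesis small_decay : forall r, 0 < r -> exists v : V, exists2 e, 0 < e &
  (forall i, 0 < v ord0 i <= r) /\ decay f g v e.

Lemma norm_box (v x : V) r : 0 <= r -> (forall i, 0 < v ord0 i <= r) ->
  box v x -> `|x| <= r.
Proof.
move=> r0 hv /boxP hx; apply: norm_le_coord => // i.
have /andP[x0 xv] := hx i; have /andP[_ vr] := hv i.
by rewrite ger0_norm// (le_trans xv).
Qed.

Lemma initial_in_scaled_box (v : V) (phi : R -> V) : (forall i, 0 < v ord0 i) ->
  init_data tau phi ->
  exists2 lam, 1 <= lam & forall t, box (lam *: v) (phi (retract tau t)).
Proof.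
move=> v0 hphi; have [m m0 hm] := positive_lower_bound v0.
have [M M0 hM] := initial_bounded tau0 hphi.
(* [M / m * v_i >= M] covers the initial data, and the summand 1 ensures [lam >= 1]. *)
exists (1 + M / m); first by rewrite lerDl divr_ge0// ltW.
move=> t; apply/boxP => i; have [_ pos] := hphi.
rewrite (pos _ (retract_in tau0 t)) mxE/=.
apply: le_trans (ler_norm _) (le_trans (coord_le_norm _ _) (le_trans (hM t) _)).
have q0 : 0 <= M / m by rewrite divr_ge0// ltW.
have := ler_wpM2l q0 (hm i); rewrite divfK ?gt_eqF// mulrDl mul1r.
by have := v0 i; lra.
Qed.

Lemma decay_GAS : GAS f g tau.
Proof.
split.
- move=> phi hphi; have [v [e e0 [hv dv]]] := small_decay ltr01.
  have v0 i : 0 < v ord0 i by have /andP[] := hv i.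
  have [lam lam1 hlam] := initial_in_scaled_box v0 hphi.
  have lv0 : nonneg (lam *: v) by move=> i; rewrite mxE mulr_ge0// ?ltW//; lra.
  have dlv := decay_scale alpha0 sf sg (ltW e0) lam1 dv.
  have [y [sy _ _]] := decay_box_solution lv0 (ltW e0) dlv hphi hlam.
  by exists y; exact: solution_of_extension sy.
- move=> eps eps0; have eps2 : 0 < eps / 2 by rewrite divr_gt0.
  have [v [e e0 [hv dv]]] := small_decay eps2.
  have v0 i : 0 < v ord0 i by have /andP[] := hv i.
  have [m m0 hm] := positive_lower_bound v0.
  (* Nonnegative data of norm below the least coordinate of [v] lie in the invariant [box v], whose
     points have norm at most [eps / 2]. *)
  exists m => // phi x hphi small sx t t0.
  have [||y [_ yv xy]] := decay_box_solution _ (ltW e0) dv hphi.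
  + by move=> i; exact: ltW.
  + move=> s; apply/boxP => i; have [_ pos] := hphi.
    rewrite (pos _ (retract_in tau0 s)) (le_trans (ler_norm _))//.
    apply: le_trans (coord_le_norm _ _) (le_trans (ltW (small _ (retract_in tau0 s))) _).
    exact: hm.
  rewrite (xy x sx); last by have := tau0; lra.
  by apply: le_lt_trans (norm_box (ltW eps2) hv (yv t)) _; lra.
(* A scaled box holding the data is invariant and shrinks to [box v], which lies in the ball of
   radius [eps]. *)
- move=> phi x hphi sx; apply/cvgrPdist_le => eps eps0.
  have [v [e e0 [hv dv]]] := small_decay eps0.
  have v0 i : 0 < v ord0 i by have /andP[] := hv i.
  have [lam lam1 hlam] := initial_in_scaled_box v0 hphi.
  have lv0 : nonneg (lam *: v) by move=> i; rewrite mxE mulr_ge0// ?ltW//; lra.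
  have dlv := decay_scale alpha0 sf sg (ltW e0) lam1 dv.
  have [y [sy yW xy]] := decay_box_solution lv0 (ltW e0) dlv hphi hlam.
  have [L [L0 lf _]] := box_lipschitz (lam *: v).
  have ev : \forall t \near pinfty_nbhs R, box v (y t).
    apply: (eventually_in_box _ tau0 e0 (ltW L0) lf _ lam1 sy yW).
      by move=> i; exact: ltW.
    by move=> mu mu1; exact: (decay_scale alpha0 sf sg (ltW e0) mu1 dv).
  near=> t; rewrite sub0r normrN (xy x sx).
    by apply: (norm_box (ltW eps0) hv); near: t.
  by near: t; exact: (nbhs_pinfty_ge (num_real _)).
Unshelve. all: by end_near. Qed.

End Main.

Theorem theorem1 (R : realType) (n : nat) (D : set 'rV[R]_n)
    (f g : 'rV[R]_n -> 'rV[R]_n) (alpha : R) :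
  open D -> (forall x, nonneg x -> D x) ->
  C1_on D f -> C1_on D g ->
  f 0 + g 0 = 0 ->
  (forall x, nonneg x -> forall i, 0 <= g x ord0 i) ->
  (forall x i, nonneg x -> x ord0 i = 0 -> 0 <= f x ord0 i) ->
  0 < alpha -> subhomogeneous alpha f -> subhomogeneous alpha g ->
  (forall w : 'rV[R]_n, nonneg w -> w != 0 ->
     exists i : 'I_n,
       sup [set g y ord0 i | y in box w] <
       - sup [set f x ord0 i | x in [set x | box w x /\ x ord0 i = w ord0 i]]) ->
  forall tau : R, 0 <= tau -> GAS f g tau.

Proof.
move=> oD DV Cf Cg fg0 g0 f0 alpha0 sf sg hsup tau tau0.
have g0' x i : nonneg x -> 0 <= g x ord0 i by move=> x0; exact: g0.
apply: (decay_GAS oD DV Cf Cg f0 g0' tau0 alpha0 sf sg).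
apply: exists_decay => //.
- by move=> r _; exact: (box_lipschitz DV Cf Cg).
- move=> w w0 wn0; have [i hi] := hsup w w0 wn0.
  by exists i; exact: (sup_gap DV Cf Cg).
Qed.
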